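(* Let $G$ be a hereditarily countably characteristically based profinite group. Then $\mathrm{Comm}(G)_A$ is a topological group (that is, there is a group topology on $\mathrm{Comm}(G)$ for which $\mathcal{B}_G$ is a base of neighborhoods of $1$). Furthermore, if $U$ is an open subgroup of $G$, the natural map $j_{U,G}:\mathrm{Comm}(U)_A\to\mathrm{Comm}(G)_A$ is a homeomorphism.
   Context: A profinite group is countably characteristically based if it has a countable base of neighborhoods of $1$ consisting of (topologically) characteristic open subgroups, and hereditarily countably characteristically based if every open subgroup is countably characteristically based. For a profinite group $U$, $\mathrm{Aut}(U)$ is the group of continuous automorphisms, with the standard topology: a base of neighborhoods of $1$ is given by the sets $A(O)=\{\gamma\in\mathrm{Aut}(U):\gamma(g)\equiv g \bmod O \text{ for all } g\in U\}$, $O$ an open subgroup of $U$. Commensurator of a profinite group $G$: a virtual automorphism of $G$ is a topological isomorphism between two open subgroups of $G$; two are equivalent if they coincide on some open subgroup; the equivalence classes form, under composition (after restricting to suitable open subgroups), a group $\mathrm{Comm}(G)$. For an open subgroup $U$ of $G$, $\rho_U:\mathrm{Aut}(U)\to\mathrm{Comm}(G)$ sends an automorphism to its class, and $j_{U,G}:\mathrm{Comm}(U)\to\mathrm{Comm}(G)$ is the isomorphism obtained by regarding a virtual automorphism of $U$ as a virtual automorphism of $G$. Let $\mathcal{B}_G$ be the set of all subgroups $H$ of $\mathrm{Comm}(G)$ such that $\rho_O^{-1}(H)$ is open in $\mathrm{Aut}(O)$ for every open subgroup $O$ of $G$. The Aut-topology on $\mathrm{Comm}(G)$ is the (translation-invariant)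 topology for which $\mathcal{B}_G$ is a base of neighborhoods of $1$; $\mathrm{Comm}(G)_A$ denotes $\mathrm{Comm}(G)$ with this topology. *)

(* Defs.v *)
From HB Require Import structures.
From mathcomp Require Import all_boot.
From mathcomp Require Import boolp classical_sets functions cardinality topology.

Set Implicit Arguments.
Unset Strict Implicit.
Unset Printing Implicit Defensive.

Local Open Scope quotient_scope.
Local Open Scope classical_set_scope.
Local Open Scope group_scope.

#[short(type="preTopologicalGroupType")]
HB.structure Definition PreTopologicalGroup := {G of Group G & Topological G}.

HB.mixin Record PreTopologicalGroup_isTopologicalGroup G
    & PreTopologicalGroup G := {
  mulg_continuous : continuous (fun x : G * G => x.1 * x.2);
  invg_continuous : continuous (fun x : G => x^-1)
}.

#[short(type="topologicalGroupType")]
HB.structure Definition TopologicalGroup :=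
  {G of PreTopologicalGroup G & PreTopologicalGroup_isTopologicalGroup G}.

HB.mixin Record TopologicalGroup_isProfinite G & TopologicalGroup G := {
  profinite_compact : compact [set: G];
  profinite_hausdorff : hausdorff_space G;
  profinite_disconnected : totally_disconnected [set: G]
}.

#[short(type="profiniteGroupType")]
HB.structure Definition ProfiniteGroup :=
  {G of TopologicalGroup G & TopologicalGroup_isProfinite G}.

Definition is_topological_group (M : preTopologicalGroupType) : Prop :=
  continuous (fun x : M * M => x.1 * x.2) /\ continuous (fun x : M => x^-1).

Definition homeomorphism (S T : topologicalType) (f : S -> T) : Prop :=
  exists g : T -> S,
    [/\ cancel f g, cancel g f, continuous f & continuous g].

Definition nbhs_base (T : topologicalType) (x : T) (B : set (set T)) : Prop :=
  B `<=` nbhs x /\ forall S, nbhs x S -> exists2 A, B A & A `<=` S.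

Definition subgroup (M : groupType) (H : set M) : Prop :=
  [/\ H 1, forall x y, H x -> H y -> H (x * y) & forall x, H x -> H x^-1].

Lemma subgroupI (M : groupType) (H K : set M) :
  subgroup H -> subgroup K -> subgroup (H `&` K).
Proof.
move=> [H1 HM HV] [K1 KM KV]; split; first by split.
  by move=> x y [? ?] [? ?]; split; [exact: HM|exact: KM].
by move=> x [? ?]; split; [exact: HV|exact: KV].
Qed.

(* The topology on a group for which the left cosets x * H, with H in a given
   family of subgroups, form a base of neighborhoods of x. *)
Section CosetTopology.
Variables (M : groupType) (B : set (set M)).
Hypothesis B0 : B !=set0.
Hypothesis BI : forall H K, B H -> B K -> B (H `&` K).
Hypothesis Bsub : forall H, B H -> subgroup H.

Definition coset_nbhs (x : M) : set_system M :=
  [set S | exists2 H, B H & forall h, H h -> S (x * h)].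

Lemma coset_nbhs_filter x : ProperFilter (coset_nbhs x).
Proof.
apply: Build_ProperFilter_ex => [S [H BH HS]|].
  by exists (x * 1); apply: HS; case: (Bsub BH).
split; first by case: B0 => H BH; exists H.
  move=> S T [H BH HS] [K BK KT]; exists (H `&` K); first exact: BI.
  by move=> h [? ?]; split; [exact: HS|exact: KT].
by move=> S T ST [H BH HS]; exists H => // h /HS /ST.
Qed.

Lemma coset_nbhs_singleton x S : coset_nbhs x S -> S x.
Proof. by move=> [H /Bsub[H1 _ _] HS]; rewrite -(mulg1 x); exact: HS. Qed.

Lemma coset_nbhs_nbhs x S : coset_nbhs x S -> coset_nbhs x (coset_nbhs^~ S).
Proof.
move=> [H BH HS]; exists H => // h Hh; exists H => // k Hk.
by rewrite -mulgA; apply: HS; case: (Bsub BH) => _ + _; exact.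
Qed.

End CosetTopology.

Record openSubgroup (G : topologicalGroupType) := OpenSubgroup {
  osub_set :> set G;
  osub_subgroup : subgroup osub_set;
  osub_open : open osub_set
}.

Section OpenSubgroupGroup.
Variables (G : topologicalGroupType) (U : openSubgroup G).
Implicit Types x y : U.

Lemma osub_valP x : osub_set U (val x).
Proof. exact: set_valP. Qed.

Lemma osub1_subproof : osub_set U 1. Proof. by case: (osub_subgroup U). Qed.
Lemma osubM_subproof x y : osub_set U (val x * val y).
Proof. by case: (osub_subgroup U) => _ + _; apply; exact: osub_valP. Qed.
Lemma osubV_subproof x : osub_set U (val x)^-1.
Proof. by case: (osub_subgroup U) => _ _; apply; exact: osub_valP. Qed.

Definition osub1 : U := exist _ 1 (mem_set osub1_subproof).
Definition osubM x y : U := exist _ (val x * val y) (mem_set (osubM_subproof x y)).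
Definition osubV x : U := exist _ (val x)^-1 (mem_set (osubV_subproof x)).

Lemma osub_mulA : associative osubM.
Proof. by move=> x y z; apply: val_inj; rewrite /= mulgA. Qed.
Lemma osub_mul1 : left_id osub1 osubM.
Proof. by move=> x; apply: val_inj; rewrite /= mul1g. Qed.
Lemma osub_mulr1 : right_id osub1 osubM.
Proof. by move=> x; apply: val_inj; rewrite /= mulg1. Qed.
Lemma osub_mulV : left_inverse osub1 osubV osubM.
Proof. by move=> x; apply: val_inj; rewrite /= mulVg. Qed.
Lemma osub_mulrV : right_inverse osub1 osubV osubM.
Proof. by move=> x; apply: val_inj; rewrite /= mulgV. Qed.

HB.instance Definition _ := isGroup.Build (set_type U)
  osub_mulA osub_mul1 osub_mulr1 osub_mulV osub_mulrV.

End OpenSubgroupGroup.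

Section SubtypeTopology.
Variables (T : topologicalType) (A : set T).

Lemma sub_val_continuous : continuous (val : A -> T).
Proof. exact: (@initial_continuous A T set_val). Qed.

Lemma sub_openP (O : set A) :
  open O -> exists2 V : set T, open V & val @^-1` V = O.
Proof. by case=> V oV <-; exists V. Qed.

Definition corestr (S : Type) (f : S -> T) (fA : forall s, A (f s)) (s : S) : A :=
  exist _ (f s) (mem_set (fA s)).

Lemma sub_continuousP (S : topologicalType) (f : S -> A) :
  continuous (fun s => val (f s)) -> continuous f.
Proof.
move=> /continuousP cf; apply/continuousP => O /sub_openP[V oV <-].
exact: (cf V).
Qed.

Lemma corestr_continuous (S : topologicalType) (f : S -> T)
  (fA : forall s, A (f s)) : continuous f -> continuous (corestr fA).
Proof. by move=> cf; apply: sub_continuousP. Qed.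

End SubtypeTopology.

Section OpenSubgroupTopology.
Variables (G : topologicalGroupType) (U : openSubgroup G).

Lemma osub_mulg_continuous : continuous (fun x : U * U => x.1 * x.2).
Proof.
apply: sub_continuousP => -[x y].
apply: (@continuous_comp _ _ _ (fun z : U * U => (val z.1, val z.2))
  (fun z : G * G => z.1 * z.2)); last exact: mulg_continuous.
apply: cvg_pair => /=.
  by apply: (cvg_comp _ _ (@cvg_fst _ _ _ _ _)); exact: sub_val_continuous.
by apply: (cvg_comp _ _ (@cvg_snd _ _ _ _ _)); exact: sub_val_continuous.
Qed.

Lemma osub_invg_continuous : continuous (fun x : U => x^-1).
Proof.
apply: sub_continuousP => x.
apply: (@continuous_comp _ _ _ (fun z : U => val z) (fun z : G => z^-1)).
  exact: sub_val_continuous.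
exact: invg_continuous.
Qed.

HB.instance Definition _ := PreTopologicalGroup_isTopologicalGroup.Build
  (set_type U) osub_mulg_continuous osub_invg_continuous.

End OpenSubgroupTopology.

Definition osubT (G : topologicalGroupType) : openSubgroup G :=
  @OpenSubgroup G setT (And3 I (fun _ _ _ _ => I) (fun _ _ => I)) openT.

Definition osubI (G : topologicalGroupType) (U V : openSubgroup G) :
    openSubgroup G :=
  OpenSubgroup (subgroupI (osub_subgroup U) (osub_subgroup V))
    (openI (osub_open U) (osub_open V)).

Section OpenSubgroupImage.
Variables (G : topologicalGroupType) (U : openSubgroup G) (W : openSubgroup U).

Lemma osub_img_subgroup : subgroup [set val x | x in osub_set W].
Proof.
have [W1 WM WV] := osub_subgroup W; split; first by exists 1.
  by move=> _ _ [x Wx <-] [y Wy <-]; exists (x * y) => //; exact: WM.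
by move=> _ [x Wx <-]; exists x^-1 => //; exact: WV.
Qed.

Lemma osub_img_open : open [set val x | x in osub_set W].
Proof.
have [V oV VW] := sub_openP (osub_open W).
rewrite (_ : [set _ | _ in _] = osub_set U `&` V).
  exact: openI (osub_open U) oV.
apply/seteqP; split=> [_ [x Wx <-]|x [Ux Vx]].
  by split; [exact: osub_valP|move: Wx; rewrite -VW].
by exists (exist _ x (mem_set Ux)); rewrite -?VW.
Qed.

(* An open subgroup of U, regarded as an open subgroup of G. *)
Definition osub_img : openSubgroup G :=
  OpenSubgroup osub_img_subgroup osub_img_open.

End OpenSubgroupImage.

Section OpenSubgroupTrace.
Variables (G : topologicalGroupType) (U V : openSubgroup G).

Lemma osub_trace_subgroup : subgroup [set x : U | osub_set V (val x)].
Proof.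
have [V1 VM VV] := osub_subgroup V; split => //.
  by move=> x y; exact: VM.
by move=> x; exact: VV.
Qed.

Lemma osub_trace_open : open [set x : U | osub_set V (val x)].
Proof. by exists (osub_set V); first exact: osub_open. Qed.

(* U `&` V as an open subgroup of U. *)
Definition osub_trace : openSubgroup U :=
  OpenSubgroup osub_trace_subgroup osub_trace_open.

End OpenSubgroupTrace.

Record topIso (H K : preTopologicalGroupType) := TopIso {
  iso_fun :> H -> K;
  iso_inv : K -> H;
  isoM : {morph iso_fun : x y / x * y};
  isoK : cancel iso_fun iso_inv;
  isoVK : cancel iso_inv iso_fun;
  iso_continuous : continuous iso_fun;
  iso_inv_continuous : continuous iso_inv
}.

Section TopIso.
Variables H K L : preTopologicalGroupType.

Lemma topIsoP (f g : topIso H K) : f =1 g -> f = g.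
Proof.
case: f g => [f f' fM fK f'K fc f'c] [g g' gM gK g'K gc g'c] /= fg.
have {}fg : f = g by apply/funext.
have {}fg' : f' = g'.
  by apply/funext => x; rewrite -{1}(g'K x) -fg fK.
subst g g'; congr TopIso; exact: Prop_irrelevance.
Qed.

Lemma isoV_morph (f : topIso H K) : {morph iso_inv f : x y / x * y}.
Proof.
by move=> x y; rewrite -{1}(isoVK f x) -{1}(isoVK f y) -isoM isoK.
Qed.

Definition topIso_id : topIso H H :=
  @TopIso H H id id (fun _ _ => erefl) (fun _ => erefl) (fun _ => erefl)
    (fun _ => cvg_id) (fun _ => cvg_id).

Definition topIso_sym (f : topIso H K) : topIso K H :=
  TopIso (@isoV_morph f) (isoVK f) (isoK f)
    (@iso_inv_continuous _ _ f) (@iso_continuous _ _ f).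

Lemma topIso_compM (f : topIso K L) (g : topIso H K) :
  {morph f \o g : x y / x * y}.
Proof. by move=> x y; rewrite /= !isoM. Qed.

Definition topIso_comp (f : topIso K L) (g : topIso H K) : topIso H L :=
  TopIso (@topIso_compM f g) (can_comp (isoK f) (isoK g))
    (can_comp (isoVK g) (isoVK f))
    (fun x => continuous_comp (@iso_continuous _ _ g x)
                              (@iso_continuous _ _ f (g x)))
    (fun x => continuous_comp (@iso_inv_continuous _ _ f x)
                              (@iso_inv_continuous _ _ g (iso_inv f x))).

End TopIso.

(* Aut(U); an automorphism is required to have a continuous inverse, which for
   profinite U is automatic. The product is composition. *)
Definition contAut (U : topologicalGroupType) : Type := topIso U U.

Section AutGroup.
Variable U : topologicalGroupType.
Local Notation A := (contAut U).

HB.instance Definition _ := gen_eqMixin A.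
HB.instance Definition _ := gen_choiceMixin A.

Lemma aut_mulA : associative (@topIso_comp U U U : A -> A -> A).
Proof. by move=> f g h; apply: topIsoP. Qed.
Lemma aut_mul1 : left_id (topIso_id U : A) (@topIso_comp U U U).
Proof. by move=> f; apply: topIsoP. Qed.
Lemma aut_mulr1 : right_id (topIso_id U : A) (@topIso_comp U U U).
Proof. by move=> f; apply: topIsoP. Qed.
Lemma aut_mulV :
  left_inverse (topIso_id U : A) (@topIso_sym U U) (@topIso_comp U U U).
Proof. by move=> f; apply: topIsoP => x /=; rewrite isoK. Qed.
Lemma aut_mulrV :
  right_inverse (topIso_id U : A) (@topIso_sym U U) (@topIso_comp U U U).
Proof. by move=> f; apply: topIsoP => x /=; rewrite isoVK. Qed.

HB.instance Definition _ := isGroup.Build A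
  aut_mulA aut_mul1 aut_mulr1 aut_mulV aut_mulrV.

(* A(O); the congruence modulo O is equality of left cosets of O. As g ranges
   over the whole group, right cosets give the same set. *)
Definition aut_cong (O : openSubgroup U) : set (contAut U) :=
  [set c | forall g : U, osub_set O (g^-1 * iso_fun c g)].

Definition aut_base : set (set (contAut U)) := range aut_cong.

Lemma aut_base0 : aut_base !=set0.
Proof. by exists (aut_cong (osubT U)); exists (osubT U). Qed.

Lemma aut_baseI H K : aut_base H -> aut_base K -> aut_base (H `&` K).
Proof.
move=> [O _ <-] [P _ <-]; exists (osubI O P) => //.
by apply/seteqP; split=> [c h|c [h1 h2] g]; split=> // g; case: (h g).
Qed.

Lemma aut_base_subgroup H : aut_base H -> subgroup H.
Proof.
move=> [O _ <-]; have [O1 OM OV] := osub_subgroup O; split.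
- by move=> g; rewrite mulVg.
- move=> c d Hc Hd g.
  rewrite -[_ * _]/(g^-1 * c (d g)) -(mulVKg (d g) (c (d g))) mulgA.
  exact: OM.
- move=> c Hc g; have := OV _ (Hc (iso_inv c g)).
  by rewrite isoVK invgM invgK.
Qed.

HB.instance Definition _ := hasNbhs.Build A (coset_nbhs aut_base).
HB.instance Definition _ := Nbhs_isNbhsTopological.Build A
  (coset_nbhs_filter aut_base0 aut_baseI aut_base_subgroup)
  (coset_nbhs_singleton aut_base_subgroup)
  (coset_nbhs_nbhs aut_base_subgroup).

End AutGroup.

Record virtAut (G : topologicalGroupType) := VirtAut {
  vdom : openSubgroup G;
  vcod : openSubgroup G;
  viso : topIso vdom vcod
}.

Definition virt_of_aut (G : topologicalGroupType) (O : openSubgroup G)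
  (c : contAut O) : virtAut G := VirtAut c.

Section VirtualAutomorphisms.
Variable G : topologicalGroupType.
Implicit Types (f g h : virtAut G) (x y z : G).

Definition virt_eq f g : Prop :=
  exists W : openSubgroup G,
    [/\ osub_set W `<=` osub_set (vdom f), osub_set W `<=` osub_set (vdom g) &
        forall (u : vdom f) (v : vdom g),
          osub_set W (val u) -> val u = val v ->
          val (viso f u) = val (viso g v)].

Definition vgraph f x y : Prop :=
  exists u : vdom f, val u = x /\ val (viso f u) = y.

Lemma vgraph_fun f x y z : vgraph f x y -> vgraph f x z -> y = z.
Proof.
by move=> [u [ux <-]] [v [vx <-]]; congr (val (viso f _)); apply: val_inj; rewrite ux.
Qed.

Lemma vgraph_ex f x : osub_set (vdom f) x -> exists y, vgraph f x y.
Proof.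
move=> fx; exists (val (viso f (exist _ x (mem_set fx)))).
by exists (exist _ x (mem_set fx)).
Qed.

Lemma vgraph_dom f x y : vgraph f x y -> osub_set (vdom f) x.
Proof. by move=> [u [<- _]]; exact: osub_valP. Qed.

Lemma virt_eqP f g : virt_eq f g <->
  exists W : openSubgroup G, forall x, osub_set W x ->
    exists y, vgraph f x y /\ vgraph g x y.
Proof.
split=> [[W [Wf Wg fg]]|[W fg]]; exists W.
  move=> x Wx; have [y [u [ux uy]]] := vgraph_ex (Wf _ Wx).
  have [z [v [vx vz]]] := vgraph_ex (Wg _ Wx).
  exists y; split; first by exists u.
  by exists v; rewrite -uy vx; split=> //; rewrite (fg u v) ?ux ?vx.
split=> [x /fg[y [/vgraph_dom]]|x /fg[y [_ /vgraph_dom]]|u v Wu uv] //.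
have [y [fy gy]] := fg _ Wu.
rewrite (@vgraph_fun f (val u) (val (viso f u)) y) //; last by exists u.
by apply: (@vgraph_fun g (val u)) => //; exists v.
Qed.

Lemma virt_eq_graph f g : (forall x y, vgraph f x y -> vgraph g x y) ->
  virt_eq f g.
Proof.
move=> fg; apply/virt_eqP; exists (vdom f) => x /vgraph_ex[y fy].
by exists y; split=> //; exact: fg.
Qed.

Lemma virt_eq_refl f : virt_eq f f.
Proof. exact: virt_eq_graph. Qed.

Lemma virt_eq_sym f g : virt_eq f g -> virt_eq g f.
Proof.
by move=> /virt_eqP[W h]; apply/virt_eqP; exists W => x /h[y [? ?]]; exists y.
Qed.

Lemma virt_eq_trans f g h : virt_eq f g -> virt_eq g h -> virt_eq f h.
Proof.
move=> /virt_eqP[W fg] /virt_eqP[V gh]; apply/virt_eqP; exists (osubI W V).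
move=> x [/fg[y [fy gy]] /gh[z [gz hz]]]; exists y; split=> //.
by rewrite (vgraph_fun gy gz).
Qed.

(* { u in vdom f | f u in A } *)
Lemma vpull_subgroup f (A : openSubgroup G) :
  subgroup [set u : vdom f | osub_set A (val (viso f u))].
Proof.
have [A1 AM AV] := osub_subgroup (osub_trace (vcod f) A).
have f1 : viso f 1 = 1.
  by apply: (mulgI (viso f 1)); rewrite -isoM !mulg1.
split.
- by have := A1; rewrite -f1.
- by move=> u v Au Av; rewrite /= isoM; exact: AM.
- move=> u Au.
  have fV : viso f u^-1 = (viso f u)^-1.
    by apply: (mulgI (viso f u)); rewrite -isoM !mulgV.
  by have := AV _ Au; rewrite -fV.
Qed.

Lemma vpull_open f (A : openSubgroup G) :
  open [set u : vdom f | osub_set A (val (viso f u))].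
Proof.
have /continuousP cf := @iso_continuous _ _ (viso f).
exact: (cf _ (osub_open (osub_trace (vcod f) A))).
Qed.

Definition vpull f (A : openSubgroup G) : openSubgroup G :=
  osub_img (OpenSubgroup (vpull_subgroup f A) (vpull_open f A)).

Lemma vpullP f (A : openSubgroup G) x :
  osub_set (vpull f A) x <-> exists2 y, vgraph f x y & osub_set A y.
Proof.
split=> [[u Au <-]|[_ [u [ux <-]]]].
  by exists (val (viso f u)) => //; exists u.
by exists u.
Qed.

Definition virt_inv f : virtAut G := VirtAut (topIso_sym (viso f)).

Lemma vgraph_inv f x y : vgraph (virt_inv f) y x <-> vgraph f x y.
Proof.
split=> [[v [<- <-]]|[u [<- <-]]].
  by exists (iso_inv (viso f) v); rewrite isoVK.
by exists (viso f u); rewrite /= isoK.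
Qed.

End VirtualAutomorphisms.

Section Composition.
Variables (G : topologicalGroupType) (f g : virtAut G).

Definition vcomp_dom : openSubgroup G := vpull g (vdom f).
Definition vcomp_cod : openSubgroup G := vpull (virt_inv f) (vcod g).

Lemma vcomp_dom1 (x : vcomp_dom) : osub_set (vdom g) (val x).
Proof. by have /vpullP[y /vgraph_dom] := osub_valP x. Qed.

Lemma vcomp_dom2 (x : vcomp_dom) :
  osub_set (vdom f) (val (viso g (corestr vcomp_dom1 x))).
Proof.
have /vpullP[y gxy fy] := osub_valP x.
rewrite (_ : val _ = y) //; apply: (vgraph_fun _ gxy).
by exists (corestr vcomp_dom1 x).
Qed.

Lemma vcomp_dom3 (x : vcomp_dom) :
  osub_set vcomp_cod (val (viso f (corestr vcomp_dom2 x))).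
Proof.
apply/vpullP; exists (val (viso g (corestr vcomp_dom1 x))).
  by apply/vgraph_inv; exists (corestr vcomp_dom2 x).
exact: osub_valP.
Qed.

Lemma vcomp_cod1 (z : vcomp_cod) : osub_set (vcod f) (val z).
Proof. by have /vpullP[y /vgraph_dom] := osub_valP z. Qed.

Lemma vcomp_cod2 (z : vcomp_cod) :
  osub_set (vcod g) (val (iso_inv (viso f) (corestr vcomp_cod1 z))).
Proof.
have /vpullP[y fyz gy] := osub_valP z.
rewrite (_ : val _ = y) //; apply: (vgraph_fun _ fyz).
by exists (corestr vcomp_cod1 z).
Qed.

Lemma vcomp_cod3 (z : vcomp_cod) :
  osub_set vcomp_dom (val (iso_inv (viso g) (corestr vcomp_cod2 z))).
Proof.
apply/vpullP; exists (val (iso_inv (viso f) (corestr vcomp_cod1 z))).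
  by apply/vgraph_inv; exists (corestr vcomp_cod2 z).
exact: osub_valP.
Qed.

Definition vcomp_fun : vcomp_dom -> vcomp_cod := corestr vcomp_dom3.
Definition vcomp_inv : vcomp_cod -> vcomp_dom := corestr vcomp_cod3.

Lemma vcomp_funM : {morph vcomp_fun : x y / x * y}.
Proof.
move=> x y; apply: val_inj => /=.
rewrite -[RHS]/(val (viso f (corestr vcomp_dom2 x) * viso f (corestr vcomp_dom2 y))).
rewrite -isoM; congr (val (viso f _)); apply: val_inj => /=.
rewrite -[RHS]/(val (viso g (corestr vcomp_dom1 x) * viso g (corestr vcomp_dom1 y))).
by rewrite -isoM; congr (val (viso g _)); apply: val_inj.
Qed.

Lemma vcomp_funK : cancel vcomp_fun vcomp_inv.
Proof.
move=> x; apply: val_inj => /=.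
rewrite [corestr vcomp_cod2 _](_ : _ = viso g (corestr vcomp_dom1 x)).
  by rewrite isoK.
apply: val_inj => /=.
rewrite [corestr vcomp_cod1 _](_ : _ = viso f (corestr vcomp_dom2 x)).
  by rewrite isoK.
exact: val_inj.
Qed.

Lemma vcomp_invK : cancel vcomp_inv vcomp_fun.
Proof.
move=> z; apply: val_inj => /=.
rewrite [corestr vcomp_dom2 _](_ : _ = iso_inv (viso f) (corestr vcomp_cod1 z)).
  by rewrite isoVK.
apply: val_inj => /=.
rewrite [corestr vcomp_dom1 _](_ : _ = iso_inv (viso g) (corestr vcomp_cod2 z)).
  by rewrite isoVK.
exact: val_inj.
Qed.

Lemma vcomp_continuous : continuous vcomp_fun.
Proof.
have c1 : continuous (corestr vcomp_dom1).
  by apply: corestr_continuous; exact: sub_val_continuous.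
have c2 : continuous (corestr vcomp_dom2).
  apply: corestr_continuous => x.
  apply: (@continuous_comp _ _ _ (fun x => viso g (corestr vcomp_dom1 x))
    (fun y : vcod g => val y)); last exact: sub_val_continuous.
  by apply: continuous_comp; [exact: c1|exact: iso_continuous].
apply: corestr_continuous => x.
apply: (@continuous_comp _ _ _ (fun x => viso f (corestr vcomp_dom2 x))
  (fun y : vcod f => val y)); last exact: sub_val_continuous.
by apply: continuous_comp; [exact: c2|exact: iso_continuous].
Qed.

Lemma vcomp_inv_continuous : continuous vcomp_inv.
Proof.
have c1 : continuous (corestr vcomp_cod1).
  by apply: corestr_continuous; exact: sub_val_continuous.
have c2 : continuous (corestr vcomp_cod2).
  apply: corestr_continuous => x.
  apply: (@continuous_comp _ _ _
    (fun x => iso_inv (viso f) (corestr vcomp_cod1 x))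
    (fun y : vdom f => val y)); last exact: sub_val_continuous.
  by apply: continuous_comp; [exact: c1|exact: iso_inv_continuous].
apply: corestr_continuous => x.
apply: (@continuous_comp _ _ _
  (fun x => iso_inv (viso g) (corestr vcomp_cod2 x))
  (fun y : vdom g => val y)); last exact: sub_val_continuous.
by apply: continuous_comp; [exact: c2|exact: iso_inv_continuous].
Qed.

(* f \o g, defined on { x in vdom g | g x in vdom f }. *)
Definition virt_comp : virtAut G :=
  VirtAut (TopIso vcomp_funM vcomp_funK vcomp_invK
    vcomp_continuous vcomp_inv_continuous).

Lemma vgraph_comp x z :
  vgraph virt_comp x z <-> exists2 y, vgraph g x y & vgraph f y z.
Proof.
split=> [[w [<- <-]]|[_ [u [<- <-]] [v [vu <-]]]].
  exists (val (viso g (corestr vcomp_dom1 w))).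
    by exists (corestr vcomp_dom1 w).
  by exists (corestr vcomp_dom2 w).
have Dx : osub_set vcomp_dom (val u).
  apply/vpullP; exists (val (viso g u)); first by exists u.
  by rewrite -vu; exact: osub_valP.
exists (exist _ (val u) (mem_set Dx)); split => //=.
congr (val (viso f _)); apply: val_inj; rewrite /= vu.
by congr (val (viso g _)); exact: val_inj.
Qed.

End Composition.

Section Commensurator.
Variable G : topologicalGroupType.
Implicit Types f g h : virtAut G.

HB.instance Definition _ := gen_eqMixin (virtAut G).
HB.instance Definition _ := gen_choiceMixin (virtAut G).

Definition virt_eqb : rel (virtAut G) := fun f g => `[< virt_eq f g >].

Lemma virt_eqb_refl : reflexive virt_eqb.
Proof. by move=> f; apply/asboolP; exact: virt_eq_refl. Qed.
Lemma virt_eqb_sym : symmetric virt_eqb.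
Proof.
by move=> f g; apply/asboolP/asboolP => ?; exact: virt_eq_sym.
Qed.
Lemma virt_eqb_trans : transitive virt_eqb.
Proof.
by move=> g f h /asboolP fg /asboolP gh; apply/asboolP; exact: virt_eq_trans gh.
Qed.

Canonical virt_equiv :=
  EquivRel virt_eqb virt_eqb_refl virt_eqb_sym virt_eqb_trans.

Definition Comm := {eq_quot virt_equiv}.

HB.instance Definition _ := Choice.on Comm.
HB.instance Definition _ := EqQuotient.on Comm.

Lemma comm_piP f g : \pi_Comm f = \pi_Comm g <-> virt_eq f g.
Proof.
split=> [/eqquotP/asboolP //|fg]; apply/eqquotP; exact/asboolP.
Qed.

Lemma comm_reprP f : virt_eq (repr (\pi_Comm f)) f.
Proof. by apply/comm_piP; rewrite reprK. Qed.

Lemma virt_comp_eq f f' g g' :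
  virt_eq f f' -> virt_eq g g' -> virt_eq (virt_comp f g) (virt_comp f' g').
Proof.
move=> /virt_eqP[W ff'] /virt_eqP[V gg']; apply/virt_eqP.
exists (osubI V (vpull g W)) => x [/gg'[y [gy g'y]] /vpullP[y' gy' Wy']].
have [z [fz f'z]] := ff' _ Wy'; rewrite (vgraph_fun gy' gy) in fz f'z.
by exists z; split; apply/vgraph_comp; exists y.
Qed.

Lemma virt_inv_eq f g : virt_eq f g -> virt_eq (virt_inv f) (virt_inv g).
Proof.
move=> /virt_eqP[W fg]; apply/virt_eqP; exists (vpull (virt_inv f) W).
move=> y /vpullP[x /vgraph_inv fxy /fg[z [fz gz]]]; exists x.
by rewrite (vgraph_fun fz fxy) in gz; split; apply/vgraph_inv.
Qed.

(* The product of classes is composition: [f] * [g] = [f \o g]. *)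
Definition comm_one : Comm := \pi_Comm (virt_of_aut (1 : contAut (osubT G))).
Definition comm_mul (a b : Comm) : Comm := \pi_Comm (virt_comp (repr a) (repr b)).
Definition comm_inv (a : Comm) : Comm := \pi_Comm (virt_inv (repr a)).

Lemma comm_mul_pi f g : comm_mul (\pi_Comm f) (\pi_Comm g) = \pi_Comm (virt_comp f g).
Proof. by apply/comm_piP; apply: virt_comp_eq; exact: comm_reprP. Qed.

Lemma comm_inv_pi f : comm_inv (\pi_Comm f) = \pi_Comm (virt_inv f).
Proof. by apply/comm_piP; apply: virt_inv_eq; exact: comm_reprP. Qed.

Lemma comm_mulA : associative comm_mul.
Proof.
elim/quotW=> f; elim/quotW=> g; elim/quotW=> h.
rewrite (comm_mul_pi g h) (comm_mul_pi f g).
rewrite (comm_mul_pi f (virt_comp g h)) (comm_mul_pi (virt_comp f g) h).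
apply/comm_piP; apply: virt_eq_graph => x z.
move=> /vgraph_comp[y /vgraph_comp[w hw gy] fz].
by apply/vgraph_comp; exists w => //; apply/vgraph_comp; exists y.
Qed.

Lemma vgraph_one x y : vgraph (virt_of_aut (1 : contAut (osubT G))) x y <-> x = y.
Proof.
split=> [[u [<- <-]]//|<-].
by exists (exist _ x (mem_set (I : osub_set (osubT G) x))).
Qed.

Lemma comm_mul1 : left_id comm_one comm_mul.
Proof.
elim/quotW=> f; rewrite comm_mul_pi; apply/comm_piP.
by apply: virt_eq_graph => x z /vgraph_comp[y fy /vgraph_one <-].
Qed.

Lemma comm_mulr1 : right_id comm_one comm_mul.
Proof.
elim/quotW=> f; rewrite comm_mul_pi; apply/comm_piP.
by apply: virt_eq_graph => x z /vgraph_comp[y /vgraph_one <-].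
Qed.

Lemma comm_mulV : left_inverse comm_one comm_inv comm_mul.
Proof.
elim/quotW=> f; rewrite comm_inv_pi comm_mul_pi; apply/comm_piP.
apply: virt_eq_graph => x z /vgraph_comp[y fxy /vgraph_inv fzy].
apply/vgraph_one; apply: (@vgraph_fun _ (virt_inv f) y); exact/vgraph_inv.
Qed.

Lemma comm_mulrV : right_inverse comm_one comm_inv comm_mul.
Proof.
elim/quotW=> f; rewrite comm_inv_pi comm_mul_pi; apply/comm_piP.
apply: virt_eq_graph => x z /vgraph_comp[y /vgraph_inv fyx fyz].
by apply/vgraph_one; exact: (vgraph_fun fyx fyz).
Qed.

HB.instance Definition _ := isGroup.Build Comm
  comm_mulA comm_mul1 comm_mulr1 comm_mulV comm_mulrV.

Definition rho (O : openSubgroup G) (c : contAut O) : Comm :=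
  \pi_Comm (virt_of_aut c).

End Commensurator.

Section ImageIso.
Variables (G : topologicalGroupType) (U : openSubgroup G) (W : openSubgroup U).

Lemma img_in_subproof (w : W) : osub_set (osub_img W) (val (val w)).
Proof. by exists (val w) => //; exact: osub_valP. Qed.

Lemma img_out_subproof1 (x : osub_img W) : osub_set U (val x).
Proof. by have [u _ <-] := osub_valP x; exact: osub_valP. Qed.

Lemma img_out_subproof2 (x : osub_img W) :
  osub_set W (corestr img_out_subproof1 x).
Proof.
have [u Wu ux] := osub_valP x.
by rewrite (_ : corestr _ x = u) //; apply: val_inj; rewrite /= -ux.
Qed.

Definition img_in : W -> osub_img W := corestr img_in_subproof.
Definition img_out : osub_img W -> W := corestr img_out_subproof2.

Lemma img_inM : {morph img_in : x y / x * y}.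
Proof. by move=> x y; exact: val_inj. Qed.
Lemma img_inK : cancel img_in img_out.
Proof. by move=> x; do 2!apply: val_inj. Qed.
Lemma img_outK : cancel img_out img_in.
Proof. by move=> x; exact: val_inj. Qed.

Lemma img_in_continuous : continuous img_in.
Proof.
apply: corestr_continuous => w.
apply: (@continuous_comp _ _ _ (fun w : W => val w) (fun u : U => val u));
  exact: sub_val_continuous.
Qed.

Lemma img_out_continuous : continuous img_out.
Proof. by do 2!apply: corestr_continuous; exact: sub_val_continuous. Qed.

Definition img_iso : topIso W (osub_img W) :=
  TopIso img_inM img_inK img_outK img_in_continuous img_out_continuous.

End ImageIso.

Section CommInclusion.
Variables (G : topologicalGroupType) (U : openSubgroup G).
Implicit Types f g : virtAut U.

(* A virtual automorphism of U, regarded as one of G. *)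
Definition virt_incl f : virtAut G :=
  VirtAut (topIso_comp (img_iso (vcod f))
    (topIso_comp (viso f) (topIso_sym (img_iso (vdom f))))).

Lemma vgraph_incl f x y : vgraph (virt_incl f) x y <->
  exists a b : U, [/\ vgraph f a b, val a = x & val b = y].
Proof.
split=> [[w [<- <-]]|[_ [_ [[u [<- <-]] <- <-]]]].
  exists (val (img_out w)), (val (viso f (img_out w))).
  by split=> //; exists (img_out w).
by exists (img_in u) => /=; rewrite img_inK.
Qed.

Lemma virt_incl_eq f g : virt_eq f g -> virt_eq (virt_incl f) (virt_incl g).
Proof.
move=> /virt_eqP[W fg]; apply/virt_eqP; exists (osub_img W).
move=> _ [a Wa <-]; have [b [fab gab]] := fg _ Wa.
by exists (val b); split; apply/vgraph_incl; exists a, b.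
Qed.

Definition comm_incl (a : Comm U) : Comm G := \pi_(Comm G) (virt_incl (repr a)).

Lemma comm_incl_pi f : comm_incl (\pi_(Comm U) f) = \pi_(Comm G) (virt_incl f).
Proof. by apply/comm_piP; apply: virt_incl_eq; exact: comm_reprP. Qed.

End CommInclusion.

Section AutTopology.
Variable G : topologicalGroupType.

Definition comm_base : set (set (Comm G)) :=
  [set H | subgroup H /\
    forall O : openSubgroup G, open [set c : contAut O | H (rho c)]].

Lemma comm_base0 : comm_base !=set0.
Proof. by exists setT; split=> [|O]; [split|exact: openT]. Qed.

Lemma comm_baseI H K : comm_base H -> comm_base K -> comm_base (H `&` K).
Proof.
move=> [sH oH] [sK oK]; split; first exact: subgroupI.
by move=> O; exact: openI (oH O) (oK O).
Qed.

Lemma comm_base_subgroup H : comm_base H -> subgroup H.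
Proof. by case. Qed.

(* Comm(G)_A: the alias of Comm G carrying the Aut-topology. Whether the coset
   topology is a group topology is not part of the construction. *)
Definition CommA : Type := Comm G.

HB.instance Definition _ := Group.on CommA.
HB.instance Definition _ := hasNbhs.Build CommA (coset_nbhs comm_base).
HB.instance Definition _ := Nbhs_isNbhsTopological.Build CommA
  (coset_nbhs_filter comm_base0 comm_baseI comm_base_subgroup)
  (coset_nbhs_singleton comm_base_subgroup)
  (coset_nbhs_nbhs comm_base_subgroup).

End AutTopology.

Definition commA_incl (G : topologicalGroupType) (U : openSubgroup G) :
  CommA U -> CommA G := @comm_incl G U.

Definition characteristic (U : topologicalGroupType) (K : openSubgroup U) :=
  forall c : contAut U, iso_fun c @` osub_set K = osub_set K.

Definition ccb (U : topologicalGroupType) : Prop :=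
  exists B : set (set U),
    [/\ countable B,
        forall A, B A ->
          exists2 K : openSubgroup U, characteristic K & A = osub_set K &
        nbhs_base 1 B].

Definition hereditarily_ccb (G : topologicalGroupType) : Prop :=
  forall U : openSubgroup G, ccb U.

(* Main.v *)
(* If N is a characteristic open subgroup of O and e is an open embedding of N
   into G2 with image L, then restricting to N and transporting along e gives a
   continuous homomorphism Aut(O) -> Aut(L). Every open subgroup O of G has such
   an N inside any prescribed open subgroup. For a = [f], take N inside the
   codomain of f and e = f^-1: this turns a^-1 rho_O(c) a into rho_L(d), so
   openness on Aut(L) pulls back to openness on Aut(O), the base is stable under
   conjugation, and the coset topology is a group topology. Taking instead the
   inclusions U -> G and (N inside U) N -> U shows that j_{U,G} and its inverse
   carry one base to the other. *)
Require Import Defs.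
From HB Require Import structures.
From mathcomp Require Import all_boot.
From mathcomp Require Import boolp classical_sets functions cardinality topology.

Set Implicit Arguments.
Unset Strict Implicit.
Unset Printing Implicit Defensive.

Local Open Scope quotient_scope.
Local Open Scope classical_set_scope.
Local Open Scope group_scope.

(** * Open embeddings of topological groups *)

Definition open_embedding (H K : preTopologicalGroupType) (e : H -> K) : Prop :=
  [/\ {morph e : x y / x * y}, injective e, continuous e &
      forall A : set H, open A -> open (e @` A)].

Lemma open_embedding_comp (H K L : preTopologicalGroupType) (f : K -> L) (e : H -> K) :
  open_embedding f -> open_embedding e -> open_embedding (f \o e).
Proof.
move=> [fM fI fc fo] [eM eI ec eo]; split.
- by move=> x y; rewrite /= eM fM.
- exact: inj_comp.
- by move=> x; apply: continuous_comp; [exact: ec|exact: fc].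
- by move=> A oA; rewrite -image_comp; apply: fo; exact: eo.
Qed.

Lemma open_embedding_iso (H K : preTopologicalGroupType) (f : topIso H K) :
  open_embedding f.
Proof.
split; [exact: isoM|exact: can_inj (isoK f)|exact: iso_continuous|].
move=> A oA; rewrite (_ : _ @` A = iso_inv f @^-1` A).
  by have /continuousP := @iso_inv_continuous _ _ f; apply.
apply/seteqP; split=> [_ [x Ax <-]|y Ay]; first by rewrite /= isoK.
by exists (iso_inv f y) => //; rewrite isoVK.
Qed.

Lemma open_embedding_val (G : topologicalGroupType) (U : openSubgroup G) :
  open_embedding (val : U -> G).
Proof.
split=> //; first exact: sub_val_continuous.
move=> A /sub_openP[V oV <-]; rewrite (_ : _ @` _ = osub_set U `&` V).
  exact: openI (osub_open U) oV.
apply/seteqP; split=> [_ [x Vx <-]|x [Ux Vx]]; first by split=> //; exact: osub_valP.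
by exists (exist _ x (mem_set Ux)).
Qed.

Lemma open_embedding_corestr (H : preTopologicalGroupType) (G : topologicalGroupType)
    (U : openSubgroup G) (e : H -> G) (eU : forall x, osub_set U (e x)) :
  open_embedding e -> open_embedding (corestr eU : H -> U).
Proof.
move=> [eM eI ec eo]; split.
- by move=> x y; apply: val_inj; exact: eM.
- by move=> x y /(congr1 val) /eI.
- exact: corestr_continuous.
- move=> A oA; exists (e @` A); first exact: eo.
  apply/seteqP; split=> [y [x Ax exy]|_ [x Ax <-]]; last by exists x.
  by exists x => //; apply: val_inj.
Qed.

Lemma morph1 (H K : groupType) (e : H -> K) :
  {morph e : x y / x * y} -> e 1 = 1.
Proof. by move=> eM; apply: (mulgI (e 1)); rewrite -eM !mulg1. Qed.

Lemma morphV (H K : groupType) (e : H -> K) :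
  {morph e : x y / x * y} -> {morph e : x / x^-1}.
Proof. by move=> eM x; apply: (mulgI (e x)); rewrite -eM !mulgV morph1. Qed.

Lemma subgroup_preimage (H K : groupType) (e : H -> K) (A : set K) :
  {morph e : x y / x * y} -> subgroup A -> subgroup (e @^-1` A).
Proof.
move=> eM [A1 AM AV]; split; first by rewrite /= morph1.
  by move=> x y Ax Ay; rewrite /= eM; exact: AM.
by move=> x Ax; rewrite /= morphV //; exact: AV.
Qed.

Lemma subgroup_image (H K : groupType) (e : H -> K) (A : set H) :
  {morph e : x y / x * y} -> subgroup A -> subgroup (e @` A).
Proof.
move=> eM [A1 AM AV]; split; first by exists 1 => //; rewrite morph1.
  by move=> _ _ [x Ax <-] [y Ay <-]; exists (x * y); [exact: AM|exact: eM].
by move=> _ [x Ax <-]; exists x^-1; [exact: AV|exact: morphV].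
Qed.

(** The corestriction of [e] to its range is a bijection onto an open subgroup, and its inverse is
    continuous because [e] is an open map. *)
Lemma open_embedding_range (H G : topologicalGroupType) (e : H -> G) :
  open_embedding e ->
  exists (L : openSubgroup G) (i : topIso H L), forall x, val (i x) = e x.
Proof.
move=> ee; have [eM eI ec eo] := ee.
pose L := OpenSubgroup (subgroup_image eM (osub_subgroup (osubT H))) (eo _ openT).
have eL x : osub_set L (e x) by exists x.
have [iM iI ic io] := open_embedding_corestr eL ee.
have /choice[g gP] : forall y : L, exists x, corestr eL x = y.
  by move=> y; have [x _ exy] := osub_valP y; exists x; exact: val_inj.
have gK : cancel (corestr eL) g by move=> x; apply: iI; exact: gP.
have gc : continuous g.
  apply/continuousP => A oA; rewrite (_ : _ @^-1` _ = corestr eL @` A).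
    exact: io.
  apply/seteqP; split=> [y Ay|_ [x Ax <-]]; first by exists (g y).
  by rewrite /= gK.
by exists L, (TopIso iM gK gP ic gc).
Qed.

(** * Restriction of automorphisms to characteristic subgroups *)

Lemma characteristic_restrict (O : topologicalGroupType) (N : openSubgroup O)
    (c : contAut O) : characteristic N ->
  exists d : contAut N, forall x, val (d x) = c (val x).
Proof.
move=> cN.
have cP (d : contAut O) (x : N) : osub_set N (d (val x)).
  have : [set d y | y in osub_set N] (d (val x)).
    by exists (val x) => //; exact: osub_valP.
  by rewrite cN.
pose r (d : contAut O) : N -> N := corestr (cP d).
have rM d : {morph r d : x y / x * y}.
  by move=> x y; apply: val_inj; rewrite /= isoM.
have rc d : continuous (r d).
  apply: corestr_continuous => x.
  apply: (@continuous_comp _ _ _ (fun x : N => val x) d).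
    exact: sub_val_continuous.
  exact: iso_continuous.
(* [N] is stable under [c^-1] as well as under [c], so the two restrictions are mutually inverse. *)
have rK d : cancel (r d) (r d^-1).
  by move=> x; apply: val_inj; rewrite /= isoK.
have rVK : cancel (r c^-1) (r c).
  by move=> x; apply: val_inj; rewrite /= isoVK.
by exists (TopIso (rM c) (rK c) rVK (rc c) (rc c^-1)).
Qed.

(* Continuity at 1 of the map Aut(O) -> Aut(L), c |-> i \o c|_N \o i^-1. *)
Lemma aut_transfer (O L : topologicalGroupType) (N : openSubgroup O)
    (i : topIso N L) (Q : openSubgroup L) : characteristic N ->
  exists P : openSubgroup O, forall c, aut_cong P c ->
    exists2 d : contAut L, aut_cong Q d &
      forall x : N, exists2 y : N, c (val x) = val y & d (i x) = i y.
Proof.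
move=> cN.
have oQ : open (i @^-1` osub_set Q).
  have /continuousP := @iso_continuous _ _ i; apply; exact: osub_open.
pose QN := OpenSubgroup (subgroup_preimage (@isoM _ _ i) (osub_subgroup Q)) oQ.
(* The witness comes from the preimage of [Q] under [i]: if [c] moves [h] in [N] by [z] in [QN], its
   transport moves [i h] by [i z], which lies in [Q]. *)
exists (osub_img QN) => c Pc; have [r rP] := characteristic_restrict c cN.
exists (topIso_comp i (topIso_comp r (topIso_sym i))) => [g /=|x]; last first.
  by exists (r x); [rewrite rP|rewrite /= isoK].
have [z Qz zE] := Pc (val (iso_inv i g)).
rewrite -{1}(isoVK i g) -(morphV (@isoM _ _ i)) -isoM.
by rewrite (_ : _ * _ = z) //; apply: val_inj; rewrite zE /= rP.
Qed.

(** * The homomorphisms from Aut(O) to Comm(G) and the base of the Aut-topology *)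

Section Rho.
Variable G : topologicalGroupType.

Lemma rhoM (O : openSubgroup G) : {morph @rho G O : c d / c * d}.
Proof.
move=> c d; apply: esym; rewrite /rho; etransitivity; first exact: comm_mul_pi.
apply/comm_piP; apply: virt_eq_graph => x z.
move=> /vgraph_comp[_ [u [<- <-]] [v [vu <-]]].
by exists u; split=> //=; congr (val (c _)); apply: val_inj.
Qed.

(** As [rho] is a homomorphism, the preimage of a subgroup is a subgroup of Aut(O), which is open as
    soon as it contains some A(P). *)
Lemma comm_baseP (H : set (Comm G)) : comm_base H <-> subgroup H /\
  forall O : openSubgroup G, exists P : openSubgroup O,
    forall c, aut_cong P c -> H (rho c).
Proof.
split=> -[sH HO]; split=> // O; have [H1 HM HV] := sH.
  have : [set c : contAut O | H (rho c)] 1 by rewrite /= morph1 //; exact: rhoM.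
  move: (HO O); rewrite openE => /[apply] -[_ [P _ <-] PH].
  by exists P => c /PH; rewrite /= mul1g.
have [P PH] := HO O; rewrite openE => c Hc.
exists (aut_cong P); first by exists P.
by move=> d /PH Hd; rewrite /= rhoM; exact: HM.
Qed.

End Rho.

(** Shared criterion for conjugation and for both directions of j. The condition on [d] says that it
    is e c e^-1 on the range of [e], so each use only has to compare two classes in a
    commensurator. *)
Lemma comm_base_transfer (G1 G2 : topologicalGroupType)
    (H1 : set (Comm G1)) (H2 : set (Comm G2)) :
  subgroup H1 -> comm_base H2 ->
  (forall O : openSubgroup G1, exists (N : openSubgroup O) (e : N -> G2),
    [/\ characteristic N, open_embedding e &
      forall (c : contAut O) (L : openSubgroup G2) (d : contAut L),
        osub_set L = range e ->
        (forall x : N, exists2 y : N, c (val x) = val y &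
          vgraph (virt_of_aut d) (e x) (e y)) ->
        H2 (rho d) -> H1 (rho c)]) ->
  comm_base H1.
Proof.
move=> sH1 /comm_baseP[sH2 oH2] h; apply/comm_baseP; split=> // O.
have [N [e [cN ee cd]]] := h O; have [L [i iE]] := open_embedding_range ee.
have [Q QH2] := oH2 L; have [P PQ] := aut_transfer i Q cN.
exists P => c /PQ[d /QH2 Hd dP]; apply: (cd c L d) => //.
  apply/seteqP; split=> [x Lx|_ [x _ <-]]; last by rewrite -iE; exact: osub_valP.
  exists (iso_inv i (exist _ x (mem_set Lx))) => //.
  by rewrite -iE isoVK.
move=> x; have [y cxy dxy] := dP x; exists y => //.
by exists (i x); rewrite /= dxy !iE.
Qed.

Lemma ccb_characteristic (U : topologicalGroupType) (A : set U) :
  ccb U -> open A -> A 1 ->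
  exists2 N : openSubgroup U, characteristic N & osub_set N `<=` A.
Proof.
move=> [B [_ Bc [_ BP]]] oA A1.
have /BP[S /Bc[N cN ->] NA] : nbhs 1 A by exact: open_nbhs_nbhs.
by exists N.
Qed.

(** * Conjugation invariance of the base and the group topology *)

Section Conjugation.
Variable G : topologicalGroupType.
Hypothesis hG : hereditarily_ccb G.

(** The trace of [U] is open in [O], and [O] itself has a characteristic base. Heredity matters
    here: [comm_base] tests every open subgroup [O]. *)
Lemma hccb_characteristic (O U : openSubgroup G) :
  exists2 N : openSubgroup O, characteristic N &
    forall x, osub_set N x -> osub_set U (val x).
Proof.
apply: ccb_characteristic; [exact: hG|exact: osub_open (osub_trace O U)|].
by case: (osub_subgroup U).
Qed.

Lemma comm_base_conj (a : Comm G) (H : set (Comm G)) :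
  comm_base H -> comm_base [set b | H (a^-1 * b * a)].
Proof.
elim/quotW: a => f BH; pose a : Comm G := \pi_(Comm G) f.
have aM : {morph (fun b : Comm G => a^-1 * b * a) : x y / x * y}.
  by move=> x y; rewrite !mulgA mulgK.
apply: (comm_base_transfer (subgroup_preimage aM (comm_base_subgroup BH)) BH).
move=> O; have [N cN NW] := hccb_characteristic O (vcod f).
have NW' (x : N) : osub_set (vcod f) (val (val x)) by apply/NW/osub_valP.
exists N, (fun x => val (iso_inv (viso f) (corestr NW' x))); split=> //.
  apply: (open_embedding_comp (open_embedding_val (vdom f))).
  apply: (open_embedding_comp (open_embedding_iso (topIso_sym (viso f)))).
  apply: open_embedding_corestr.
  exact: (open_embedding_comp (open_embedding_val O) (open_embedding_val N)).
have fe (x : N) : vgraph f (val (iso_inv (viso f) (corestr NW' x))) (val (val x)).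
  by exists (iso_inv (viso f) (corestr NW' x)); rewrite isoVK.
move=> c L d LE cd; rewrite /= (_ : _ * _ = rho d) //.
rewrite -[LHS]/(comm_mul (comm_mul (comm_inv (\pi_(Comm G) f)) (rho c)) (\pi_(Comm G) f)).
rewrite comm_inv_pi /rho !comm_mul_pi; apply/comm_piP/virt_eqP.
(* With e the embedding chosen above, on its range [f] carries e x to x, [c] carries x to y, and
   f^-1 carries y to e y. *)
exists L; rewrite LE => _ [x _ <-]; have [y cxy dxy] := cd x.
exists (val (iso_inv (viso f) (corestr NW' y))); split=> //.
apply/vgraph_comp; exists (val (val x)) => //.
apply/vgraph_comp; exists (val (val y)); last exact/vgraph_inv.
by exists (val x); rewrite /= -cxy.
Qed.

Lemma CommA_topological_group : is_topological_group (CommA G).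
Proof.
split=> [[x y]|x] S [H BH HS]; have [_ HM HV] := comm_base_subgroup BH.
  have BK := comm_base_conj (y : Comm G) BH.
  (* K = y H y^-1, so that x k y h = x y (y^-1 k y) h stays in the coset x y H. *)
  pose K : set (CommA G) := [set b | H (y^-1 * b * y)].
  exists ((fun k => x * k) @` K, (fun h => y * h) @` H) => /=.
    split; first by exists K => // k Kk; exists k.
    by exists H => // h Hh; exists h.
  move=> [_ _] /= [[k Kk <-] [h Hh <-]].
  rewrite [_ * _](_ : _ = x * y * (y^-1 * k * y * h)); first exact/HS/HM.
  by rewrite !mulgA mulgK.
(* The neighborhood is built from x^-1 H x because (x k)^-1 = x^-1 (x k x^-1)^-1. *)
exists [set b | H (x * b * x^-1)] => [|k Hk].
  by have := comm_base_conj (x^-1 : Comm G) BH; rewrite invgK.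
rewrite /= invgM (_ : _ * _ = x^-1 * (x * k * x^-1)^-1); first exact/HS/HV.
by rewrite !invgM invgK !mulgA mulVg mul1g.
Qed.

End Conjugation.

Lemma CommA_nbhs_base (G : topologicalGroupType) :
  nbhs_base (1 : CommA G) (@comm_base G).
Proof.
split=> [H BH|S [H BH HS]]; exists H => // h Hh; first by rewrite mul1g.
by have := HS _ Hh; rewrite mul1g.
Qed.

(** * The map j from Comm(U) to Comm(G) *)

Section Inclusion.
Variables (G : topologicalGroupType) (U : openSubgroup G).

Lemma comm_inclM : {morph @comm_incl G U : a b / a * b}.
Proof.
elim/quotW=> f; elim/quotW=> g.
rewrite -[_ * _]/(comm_mul _ _) -[RHS]/(comm_mul _ _) comm_mul_pi !comm_incl_pi.
rewrite comm_mul_pi; apply/comm_piP; apply: virt_eq_graph => x z.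
move=> /vgraph_incl[a [b [/vgraph_comp[u gau fub] <- <-]]].
by apply/vgraph_comp; exists (val u); apply/vgraph_incl; [exists a, u|exists u, b].
Qed.

(** If the images agree on [W], open in [G], the originals agree on the trace of [W] in [U]. *)
Lemma comm_incl_inj : injective (@comm_incl G U).
Proof.
elim/quotW=> f; elim/quotW=> g; rewrite !comm_incl_pi.
move=> /comm_piP/virt_eqP[W fg]; apply/comm_piP/virt_eqP.
exists (osub_trace U W) => x /fg[y [/vgraph_incl[a [b [fab ax yb]]]]].
move=> /vgraph_incl[a' [b' [gab ax' yb']]]; exists b.
rewrite -(val_inj ax); split=> //.
by rewrite (val_inj ax) -(val_inj ax') (_ : b = b') //; apply: val_inj; rewrite yb.
Qed.

(** Restricting [f] to the points of [U] whose image is again in [U] keeps its class and yields an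
    isomorphism between open subgroups of [U]. *)
Lemma comm_incl_surj (a : Comm G) : exists b, @comm_incl G U b = a.
Proof.
elim/quotW: a => f; pose M := osub_trace U (osubI (vdom f) (vpull f U)).
have Mf (x : M) : osub_set (vdom f) (val (val x)) by have [] := osub_valP x.
have MU (x : M) : osub_set U (val (viso f (corestr Mf x))).
  have [_ /vpullP[y fxy Uy]] := osub_valP x.
  rewrite (_ : val _ = y) //; apply: (vgraph_fun _ fxy).
  by exists (corestr Mf x).
have ee : open_embedding (corestr MU : M -> U).
  apply: open_embedding_corestr.
  apply: (open_embedding_comp (open_embedding_val (vcod f))).
  apply: (open_embedding_comp (open_embedding_iso (viso f))).
  apply: open_embedding_corestr.
  exact: (open_embedding_comp (open_embedding_val U) (open_embedding_val M)).
have [L [i iE]] := open_embedding_range ee.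
exists (\pi_(Comm U) (VirtAut i)); rewrite comm_incl_pi.
apply/comm_piP; apply: virt_eq_graph => _ _ /vgraph_incl[_ [_ [[x [<- <-]] <- <-]]].
by exists (corestr Mf x); rewrite /= iE.
Qed.

(** Yields continuity of j. An open subgroup of [U] is already open in [G], so N is all of [O]. *)
Lemma comm_base_preimage (H : set (Comm G)) :
  comm_base H -> comm_base (@comm_incl G U @^-1` H).
Proof.
move=> BH.
apply: (comm_base_transfer (subgroup_preimage comm_inclM (comm_base_subgroup BH)) BH).
move=> O; exists (osubT O), (fun x => val (val (val x))); split.
- by move=> c; apply/seteqP; split=> // x _; exists (iso_inv c x) => //; rewrite isoVK.
- apply: (open_embedding_comp (open_embedding_val U)).
  exact: (open_embedding_comp (open_embedding_val O) (open_embedding_val _)).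
move=> c L d LE cd; rewrite /preimage /= (_ : comm_incl _ = rho d) //.
rewrite comm_incl_pi; apply/comm_piP/virt_eqP; exists L; rewrite LE => _ [x _ <-].
have [y cxy dxy] := cd x; exists (val (val (val y))); split=> //.
apply/vgraph_incl; exists (val (val x)), (val (val y)); split=> //.
by exists (val x); rewrite /= -cxy.
Qed.

(** Yields continuity of the inverse of j. As [O] need not lie in [U], its automorphisms are first
    restricted to a characteristic [N] inside [U]. *)
Lemma comm_base_image (K : set (Comm U)) :
  hereditarily_ccb G -> comm_base K -> comm_base (@comm_incl G U @` K).
Proof.
move=> hG BK.
apply: (comm_base_transfer (subgroup_image comm_inclM (comm_base_subgroup BK)) BK).
move=> O; have [N cN NU] := hccb_characteristic hG O U.
have NU' (x : N) : osub_set U (val (val x)) by apply/NU/osub_valP.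
exists N, (corestr NU'); split=> //.
  apply: open_embedding_corestr.
  exact: (open_embedding_comp (open_embedding_val O) (open_embedding_val N)).
move=> c L d LE cd Kd; exists (rho d) => //.
rewrite comm_incl_pi; apply/comm_piP/virt_eqP; exists (osub_img L).
move=> _ [u + <-]; rewrite LE => -[x _ <-].
have [y cxy dxy] := cd x; exists (val (val y)); split.
  by apply/vgraph_incl; exists (corestr NU' x), (corestr NU' y).
by exists (val x); rewrite /= -cxy.
Qed.

Lemma commA_incl_homeomorphism :
  hereditarily_ccb G -> homeomorphism (@commA_incl G U).
Proof.
move=> hG; have /choice[g gK] := comm_incl_surj.
have Kg : cancel (@comm_incl G U) g by move=> a; apply: comm_incl_inj; rewrite gK.
have gM : {morph g : x y / x * y}.
  by move=> x y; apply: comm_incl_inj; rewrite comm_inclM !gK.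
exists g; split=> //.
  (* Since j and [g] are homomorphisms, base subgroups settle continuity at every point; the
     preimage of [K] under [g] is its image under j. *)
  move=> x S [H BH HS]; exists (@comm_incl G U @^-1` H).
    exact: comm_base_preimage.
  by move=> h Hh; rewrite /preimage /= [commA_incl _]comm_inclM; exact: HS.
move=> x S [K BK KS]; exists (@comm_incl G U @` K); first exact: comm_base_image.
by move=> _ [k Kk <-]; rewrite /preimage /= [g _]gM Kg; exact: KS.
Qed.

End Inclusion.

Theorem proposition7p3 (G : profiniteGroupType) (hG : hereditarily_ccb G) :
  (is_topological_group (CommA G) /\
   nbhs_base (1 : CommA G) (@comm_base G)) /\
  (forall U : openSubgroup G, homeomorphism (@commA_incl G U)).
Proof.
split; last by move=> U; exact: commA_incl_homeomorphism.
by split; [exact: CommA_topological_group|exact: CommA_nbhs_base].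
Qed.
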